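(* Let $F=\{b\in\mathbb{Z}:|b|\geq 3\}$ and let $\Phi_F=\{\varphi_b\}_{b\in F}$ be the iterated function system on $[-\tfrac12,\tfrac12]$ given by $\varphi_b(x)=\frac{1}{b+x}$. Then $\Phi_F$ has full Hausdorff dimension spectrum; that is, for every real $t$ with $0\leq t\leq \dim_H(J_F)$ there exists a subset $G\subseteq F$ such that $\dim_H(J_G)=t$.
   Context: $\dim_H$ denotes Hausdorff dimension. For each integer $b$ with $|b|\geq3$, the map $\varphi_b:[-\tfrac12,\tfrac12]\to[-\tfrac12,\tfrac12]$, $\varphi_b(x)=\frac1{b+x}$, is an injective contraction (an inverse branch of the nearest integer continued fraction map $T(x)=\frac1x-[\frac1x-\frac12]$ as the paper defines it). For $G\subseteq F$, the limit set $J_G\subseteq[-\tfrac12,\tfrac12]$ is the set of all points $\pi(\omega)$ with $\omega=\omega_1\omega_2\ldots\in G^{\infty}$, where $\pi(\omega)$ is the unique element of $\bigcap_{n\geq1}\varphi_{\omega_1}\circ\cdots\circ\varphi_{\omega_n}([-\tfrac12,\tfrac12])$. Equivalently, $J_G$ is the set of numbers $\cfrac{1}{\omega_1+\cfrac{1}{\omega_2+\cdots}}$ with all $\omega_i\in G$. An iterated function system $\{\varphi_e\}_{e\in I}$ with countable alphabet $I$ has full Hausdorff dimension spectrum if for each $t\in[0,\dim_H(J_I)]$ there is a subset $G\subseteq I$ with $\dim_H(J_G)=t$, where $J_G$ is the limit set of the subsystem $\{\varphi_e\}_{e\in G}$. *)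

(* Defs.v *)
(* MathComp-Analysis; the reals are an arbitrary R : realType. *)
From HB Require Import structures.
From mathcomp Require Import all_boot all_order all_algebra.
From mathcomp Require Import all_classical all_reals all_analysis.

Set Implicit Arguments.
Unset Strict Implicit.
Unset Printing Implicit Defensive.

Import Order.TTheory GRing.Theory Num.Theory.
Import numFieldNormedType.Exports.
Local Open Scope classical_set_scope.
Local Open Scope ring_scope.

Section HausdorffDimension.
Variable R : realType.
Implicit Types (s delta : R) (A : set R).

(* Only meaningful for A nonempty: [diam set0 = -oo]. *)
Definition diam A : \bar R := ereal_sup [set `|x - y|%:E | x in A & y in A].

(* |A|^s, with the usual conventions |set0|^s = 0, and 0^0 = 1 for nonempty A,
   so that the 0-dimensional measure is the counting measure. *)
Definition diam_pow s A : \bar R :=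
  if A == set0 then 0%E else (diam A `^ s)%E.

Definition hausdorff_premeasure s delta A : \bar R :=
  ereal_inf [set (\sum_(0 <= i <oo) diam_pow s (U i))%E |
    U in [set U : nat -> set R |
           A `<=` \bigcup_i U i /\ forall i, (diam (U i) <= delta%:E)%E]].

(* The premeasure is nonincreasing in delta, so this supremum is its limit as
   delta tends to 0. *)
Definition hausdorff_measure s A : \bar R :=
  ereal_sup [set hausdorff_premeasure s delta A |
              delta in [set delta : R | 0 < delta]].

Definition hausdorff_dim A : \bar R :=
  ereal_inf [set s%:E | s in [set s : R |
    0 <= s /\ hausdorff_measure s A = 0%E]].

End HausdorffDimension.

Section IteratedFunctionSystem.
Variables (R : realType) (I : countType) (phi : I -> R -> R) (X : set R).

(* phi_(w 0) \o ... \o phi_(w n.-1): words are indexed from 0. *)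
Fixpoint ifs_comp (w : nat -> I) (n : nat) : R -> R :=
  if n is m.+1 then ifs_comp w m \o phi (w m) else id.

(* [ifs_code w x] says that x is the point pi(w), i.e. the unique element of
   the intersection. *)
Definition ifs_code (w : nat -> I) (x : R) : Prop :=
  \bigcap_(n in [set n | (1 <= n)%N]) (ifs_comp w n @` X) = [set x].

Definition limit_set (G : set I) : set R :=
  [set x | exists2 w : nat -> I, (forall n, G (w n)) & ifs_code w x].

(* F is the alphabet of the system; the type I may be larger. *)
Definition full_hausdorff_dim_spectrum (F : set I) : Prop :=
  forall t : R, 0 <= t -> (t%:E <= hausdorff_dim (limit_set F))%E ->
    exists2 G : set I, G `<=` F & hausdorff_dim (limit_set G) = t%:E.

End IteratedFunctionSystem.

Definition nicf_map (R : realType) (b : int) (x : R) : R := (b%:~R + x)^-1.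

Definition nicf_alphabet : set int := [set b : int | 3 <= `|b|].

(* Main.v *)
Require Import Defs.
From mathcomp Require Import all_boot all_order all_algebra.
From mathcomp Require Import all_classical all_reals all_analysis.
From mathcomp Require Import ring lra zify.

(* For a finite digit set A let [L f x = \sum_(b in A) |phi_b' x|^s f (phi_b x)]
   be its transfer operator, so that [L^n 1] sums [|phi_u'|^s] over the words u
   of length n. Call a digit set s-subcritical when [L^n 1 <= 9/4] for all n and
   all its finite subsets. As 9/4 bounds the distortion of every [L^n 1] when
   s <= 1, these sums can only be either bounded by 9/4 or unbounded.

   The limit set of an s-subcritical set has dimension at most s: cover it by
   cylinders. Conversely, if some [L^N 1] exceeds 9/4 on a finite A, then
   [h = \sum_(k < N) L^k 1] satisfies [L h >= h]; given a cover of small total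
   s-cost, one can keep choosing a child cylinder whose share of the cost is
   smaller than its h-weight, because a covering set meeting two siblings would
   be too long. The resulting point is not covered, so the dimension is at least
   s. Hence the dimension is the threshold of subcriticality.

   For 0 < t <= 1, scan 3, -3, 4, -4, ... and accept a digit when the accepted
   set stays t-subcritical. If the outcome had dimension < t, it would be
   s-subcritical for some s < t, so every large digit would be accepted. If no
   digit is rejected then the outcome is the full alphabet. Otherwise all digits
   following the last rejected digit b are accepted; but their total weight is at
   least 9/4 times that of b, so b should have been accepted too. *)

Set Implicit Arguments.
Unset Strict Implicit.
Unset Printing Implicit Defensive.

Import Order.TTheory GRing.Theory Num.Theory.
Import numFieldNormedType.Exports.
Local Open Scope classical_set_scope.
Local Open Scope ring_scope.

Section NearestIntegerSpectrum.
Variable R : realType.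
Implicit Types (s t x y r : R) (A B T : seq int) (b : int) (f g : R -> R).
Implicit Types (w : nat -> int) (G : set int).

Local Notation phi := (@nicf_map R).
Local Notation X := (`[- 2^-1, 2^-1]%classic : set R).
Local Notation inX x := (`|x| <= 2^-1 :> R).
Local Notation digits A := (forall b, b \in A -> nicf_alphabet b).

(** * Transfer operators *)

Lemma ler_sum_sub (I : eqType) (l l' : seq I) (f : I -> R) : uniq l ->
  {subset l <= l'} -> (forall i, 0 <= f i) ->
  \sum_(i <- l) f i <= \sum_(i <- l') f i.
Proof.
move=> ul ll' f0; elim: l l' ul ll' => [|a A IH] B /=.
  by move=> _ _; rewrite big_nil sumr_ge0.
move=> /andP[aA uA] AB; have aB : a \in B by apply: AB; rewrite mem_head.
rewrite big_cons (perm_big _ (perm_to_rem aB)) big_cons lerD2l.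
apply: IH => // z zA; have : z \in B by apply: AB; rewrite inE zA orbT.
rewrite (perm_mem (perm_to_rem aB)) inE => /orP[/eqP za|//].
by move: aA; rewrite -za zA.
Qed.

Lemma digit_ge3 b : nicf_alphabet b -> 3 <= `|b%:~R| :> R.
Proof. by rewrite /nicf_alphabet/= -intr_norm -(ler_int R). Qed.

Lemma digit_addr_ge b x : nicf_alphabet b -> inX x -> 5 / 2 <= `|b%:~R + x|.
Proof.
move=> /digit_ge3 hb hx; have := lerB_normD b%:~R x.
by move: hb hx; lra.
Qed.

Lemma digit_addr_neq0 b x : nicf_alphabet b -> inX x -> b%:~R + x != 0.
Proof. by move=> hb hx; rewrite -normr_gt0; have := digit_addr_ge hb hx; lra. Qed.

Lemma nicf_map_le b x : nicf_alphabet b -> inX x -> `|phi b x| <= 2 / 5.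
Proof.
move=> hb hx; have h := digit_addr_ge hb hx.
rewrite /nicf_map normfV invf_ple ?posrE; lra.
Qed.

Lemma nicf_map_inX b x : nicf_alphabet b -> inX x -> inX (phi b x).
Proof. by move=> hb hx; have := nicf_map_le hb hx; lra. Qed.

(** Since phi_b'(x) = -(b + x)^-2, the square [phi b x ^+ 2] is |phi_b'(x)|. *)
Definition transfer s A f x : R :=
  \sum_(b <- A) ((phi b x ^+ 2) `^ s) * f (phi b x).

Definition pressure_sum s A n : R -> R := iter n (transfer s A) (fun=> 1).

Lemma transfer_le s A f g : digits A ->
  (forall x, inX x -> f x <= g x) ->
  forall x, inX x -> transfer s A f x <= transfer s A g x.
Proof.
move=> hA fg x hx; rewrite /transfer !big_seq; apply: ler_sum => b bA.
by apply: ler_wpM2l; [exact: powR_ge0 | apply/fg/nicf_map_inX/hx/hA].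
Qed.

Lemma iter_transfer_le s A f g n : digits A ->
  (forall x, inX x -> f x <= g x) ->
  forall x, inX x -> iter n (transfer s A) f x <= iter n (transfer s A) g x.
Proof.
by move=> hA fg; elim: n => [//|n IH] x hx /=; apply: transfer_le.
Qed.

Lemma transferZ s A c f x :
  transfer s A (fun y => c * f y) x = c * transfer s A f x.
Proof. by rewrite /transfer mulr_sumr; apply: eq_bigr => b _; ring. Qed.

Lemma iter_transfer_scale s A c f n x :
  iter n (transfer s A) (fun y => c * f y) x = c * iter n (transfer s A) f x.
Proof.
elim: n x => [//|n IH] x /=; rewrite -transferZ.
by congr transfer; apply/funext => y.
Qed.

Lemma pressure_sumS s A n x :
  pressure_sum s A n.+1 x = transfer s A (pressure_sum s A n) x.
Proof. by []. Qed.

Lemma pressure_sumD s A m n x :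
  pressure_sum s A (m + n) x = iter m (transfer s A) (pressure_sum s A n) x.
Proof. by rewrite /pressure_sum iterD. Qed.

Lemma transfer_cat s A B f x :
  transfer s (A ++ B) f x = transfer s A f x + transfer s B f x.
Proof. by rewrite /transfer big_cat. Qed.

Lemma transfer_cons s b A f x :
  transfer s (b :: A) f x =
  ((phi b x ^+ 2) `^ s) * f (phi b x) + transfer s A f x.
Proof. by rewrite /transfer big_cons. Qed.

Lemma transfer_sum s A N (F : nat -> R -> R) x :
  transfer s A (fun y => \sum_(k < N) F k y) x = \sum_(k < N) transfer s A (F k) x.
Proof.
rewrite /transfer exchange_big; apply: eq_bigr => b _.
by rewrite mulr_sumr.
Qed.

(** Telescoping: L shifts the sum h by one index. Hence L h >= h where L^N 1 >= 1, and L h <= h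
    where L^N 1 <= 1; the lower and upper estimates below use one case each. *)
Lemma transfer_sum_pressure s A N x :
  transfer s A (fun y => \sum_(k < N) pressure_sum s A k y) x =
  \sum_(k < N) pressure_sum s A k x - 1 + pressure_sum s A N x.
Proof.
have E : \sum_(k < N) pressure_sum s A k x + pressure_sum s A N x =
    1 + \sum_(k < N) pressure_sum s A k.+1 x.
  transitivity (\sum_(k < N.+1) pressure_sum s A k x).
    by rewrite big_ord_recr.
  by rewrite big_ord_recl.
by rewrite transfer_sum addrAC E addrAC subrr add0r.
Qed.

Lemma pressure_sum_ge0 s A n x : 0 <= pressure_sum s A n x.
Proof.
elim: n x => [|n IH] x /=; first exact: ler01.
by apply: sumr_ge0 => b _; rewrite mulr_ge0// powR_ge0.
Qed.

Lemma transfer_sub s A B f x : uniq A -> {subset A <= B} ->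
  (forall y, 0 <= f y) -> transfer s A f x <= transfer s B f x.
Proof.
by move=> uA AB f0; apply: ler_sum_sub => // b; rewrite mulr_ge0 ?powR_ge0.
Qed.

Lemma pressure_sum_sub s A B n : uniq A -> {subset A <= B} -> digits B ->
  forall x, inX x -> pressure_sum s A n x <= pressure_sum s B n x.
Proof.
move=> uA AB hB; elim: n => [//|n IH] x hx.
rewrite !pressure_sumS; apply: le_trans (transfer_sub _ _ uA AB _) _ => [y|].
  exact: pressure_sum_ge0.
exact: transfer_le.
Qed.

(** The weights are powers of squares of points phi_b(x), which lie in [-2/5, 2/5], so each of the n
    letters yields one factor rho. *)
Lemma pressure_sum_le_exponent s t rho A n : digits A ->
  (forall y, `|y| <= 2 / 5 -> (y ^+ 2) `^ t <= rho * (y ^+ 2) `^ s) -> 0 <= rho ->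
  forall x, inX x -> pressure_sum t A n x <= rho ^+ n * pressure_sum s A n x.
Proof.
move=> hA hrho rho0; elim: n => [|n IH] x hx.
  by rewrite expr0 mul1r.
rewrite !pressure_sumS /transfer !big_seq mulr_sumr; apply: ler_sum => b bA.
rewrite [rho ^+ _.+1]exprS mulrACA ler_pM ?powR_ge0 ?pressure_sum_ge0//.
  by apply: hrho; apply: nicf_map_le => //; exact: hA.
by apply: IH; apply: nicf_map_inX => //; exact: hA.
Qed.

(** * Bounded distortion *)

Lemma small_expr (rho e : R) : 0 <= rho -> rho < 1 -> 0 < e -> exists n, rho ^+ n < e.
Proof.
move=> rho0 rho1 e0; have /cvgrPdist_lt/(_ e e0) :
    (GRing.exp rho : R ^nat) x @[x --> \oo] --> (0:R).
  by apply: cvg_expr; rewrite ger0_norm.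
move=> [n _ /(_ n (leqnn n))]; rewrite /= sub0r normrN ger0_norm ?exprn_ge0// => h.
by exists n.
Qed.

(* Every |phi_u'|^s has the form c (1 + r x)^(-2s) with |r| <= 2/5. *)
Definition cone s f := exists2 l : seq (R * R),
  (forall p, p \in l -> 0 <= p.1 /\ `|p.2| <= 2 / 5) &
  forall x, inX x -> f x = \sum_(p <- l) p.1 * ((1 + p.2 * x) ^- 2) `^ s.

Lemma cone1 s : cone s (fun=> 1).
Proof.
exists [:: (1, 0)] => [p|x _]; last by rewrite big_seq1/= mul0r addr0 expr1n invr1 powR1 mulr1.
by rewrite inE => /eqP -> /=; rewrite normr0 ler01; split => //; lra.
Qed.

Lemma inX_mul r x : `|r| <= 2 / 5 -> inX x -> `|r * x| <= 5^-1.
Proof.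
move=> hr hx; rewrite normrM.
apply: (@le_trans _ _ ((2/5) * 2^-1)); first by rewrite ler_pM.
lra.
Qed.

Lemma inX_mul_itv r x : `|r| <= 2 / 5 -> inX x -> 4 / 5 <= 1 + r * x <= 6 / 5.
Proof. by move=> hr hx; have := inX_mul hr hx; rewrite ler_norml; lra. Qed.

(** Both sides are (b + x + r)^-2, because (b + x)(1 + r phi_b(x)) = b + x + r = (b + r)(1 +
    phi_b(r) x). This is why L preserves the cone: it moves the parameter r to phi_b(r). *)
Lemma nicf_map_kernel b x r : nicf_alphabet b -> inX x -> `|r| <= 2 / 5 ->
  phi b x ^+ 2 * (1 + r * phi b x) ^- 2 = phi b r ^+ 2 * (1 + phi b r * x) ^- 2.
Proof.
move=> hb hx hr; have hr' : inX r by lra.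
have hbx := digit_addr_neq0 hb hx; have hbr := digit_addr_neq0 hb hr'.
have h : b%:~R + x + r != 0.
  rewrite -normr_gt0 -addrA.
  have := lerB_normD b%:~R (x + r); have := ler_normD x r.
  by have := digit_ge3 hb; lra.
rewrite -!exprVn -!exprMn; congr (_ ^+ 2); rewrite /nicf_map.
rewrite -!invfM; congr (_^-1).
by field; rewrite hbx hbr.
Qed.

Lemma cone_transfer s A f : digits A -> cone s f -> cone s (transfer s A f).
Proof.
move=> hA [l lP fE].
exists [seq ((phi b p.2 ^+ 2) `^ s * p.1, phi b p.2) | b <- A, p <- l].
  move=> p /allpairsP[[b q] /= [bA ql ->]] /=; have [q1 q2] := lP _ ql.
  split; first by rewrite mulr_ge0// powR_ge0.
  by apply: nicf_map_le; [exact: hA | lra].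
move=> x hx; rewrite big_allpairs_dep /transfer !big_seq; apply: eq_bigr => b bA.
rewrite fE; last by apply: nicf_map_inX => //; exact: hA.
rewrite mulr_sumr !big_seq; apply: eq_bigr => p pl /=.
have [p1 p2] := lP _ pl.
rewrite mulrCA [RHS]mulrAC mulrC; congr (_ * _).
rewrite -!powRM ?sqr_ge0 ?invr_ge0 ?sqr_ge0//.
by rewrite nicf_map_kernel//; exact: hA.
Qed.

Lemma cone_pressure_sum s A n : digits A -> cone s (pressure_sum s A n).
Proof.
by move=> hA; elim: n => [|n IH]; [exact: cone1 | exact: cone_transfer].
Qed.

(** The constant 9/4 is ((6/5) / (4/5))^2. *)
Lemma inv_sqr_distortion u v : 4 / 5 <= u <= 6 / 5 -> 4 / 5 <= v <= 6 / 5 ->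
  u ^- 2 <= 9 / 4 * v ^- 2 :> R.
Proof.
move=> /andP[u1 u2] /andP[v1 v2].
have u0 : 0 < u by lra.
have v0 : 0 < v by lra.
rewrite ler_pdivlMr ?exprn_gt0// mulrC ler_pdivrMr ?exprn_gt0//.
nra.
Qed.

Lemma cone_distortion s f x y : 0 <= s <= 1 -> cone s f -> inX x -> inX y ->
  f x <= 9 / 4 * f y.
Proof.
move=> /andP[s0 s1] [l lP fE] hx hy; rewrite !fE// mulr_sumr !big_seq.
apply: ler_sum => p pl; have [p1 p2] := lP _ pl.
rewrite mulrCA ler_wpM2l//.
have h := inv_sqr_distortion (inX_mul_itv p2 hx) (inX_mul_itv p2 hy).
apply: (@le_trans _ _ ((9 / 4 * (1 + p.2 * y) ^- 2) `^ s)).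
  apply: ge0_ler_powR => //; rewrite nnegrE ?invr_ge0 ?sqr_ge0//.
  by rewrite mulr_ge0 ?invr_ge0 ?sqr_ge0.
rewrite powRM ?invr_ge0 ?sqr_ge0//.
(* Here s <= 1 enters, through (9/4)^s <= 9/4. *)
by rewrite ler_wpM2r ?powR_ge0// ler1_powR//; lra.
Qed.

Lemma pressure_sum_distortion s A n x y : 0 <= s <= 1 -> digits A ->
  inX x -> inX y -> pressure_sum s A n x <= 9 / 4 * pressure_sum s A n y.
Proof. by move=> hs hA; exact: (cone_distortion hs (cone_pressure_sum s n hA)). Qed.

(** If L^m 1 exceeds 9/4 at one point, then by distortion it is at least some a > 1 on the whole
    interval. Iterating, L^(km) 1 >= a^k, which outgrows every M. *)
Lemma pressure_sum_bootstrap s A M : 0 <= s <= 1 -> digits A ->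
  (forall n x, inX x -> pressure_sum s A n x <= M) ->
  forall n x, inX x -> pressure_sum s A n x <= 9 / 4.
Proof.
move=> hs hA hM m x hx; rewrite leNgt; apply/negP => hgt.
pose a := pressure_sum s A m x / (9 / 4).
have a1 : 1 < a by rewrite /a ltr_pdivlMr ?mul1r//; lra.
have ha y : inX y -> a <= pressure_sum s A m y.
  move=> hy; have := pressure_sum_distortion m hs hA hx hy.
  by rewrite /a ler_pdivrMr; lra.
have h k y : inX y -> a ^+ k <= pressure_sum s A (k * m) y.
  elim: k y => [|k IH] y hy; first by rewrite expr0.
  rewrite mulSn pressure_sumD exprSr.
  apply: (@le_trans _ _ (a ^+ k * pressure_sum s A m y)).
    by rewrite ler_wpM2l ?exprn_ge0// ?ha//; lra.
  rewrite -iter_transfer_scale; apply: iter_transfer_le => // z hz.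
  by rewrite mulr1; exact: IH.
have M0 : 0 < M by apply: lt_le_trans (hM m x hx); lra.
have [k] : exists k, a^-1 ^+ k < M^-1.
  by apply: small_expr; rewrite ?invr_ge0 ?invf_lt1 ?invr_gt0//; lra.
rewrite exprVn ltf_pV2 ?posrE ?exprn_gt0//; last lra.
by rewrite ltNge (le_trans (h k x hx))// hM.
Qed.

(** * Subcritical digit sets *)

Lemma pressure_sum_supersolution s A g : digits A ->
  (forall x, inX x -> 1 <= g x) -> (forall x, inX x -> transfer s A g x <= g x) ->
  forall n x, inX x -> pressure_sum s A n x <= g x.
Proof.
move=> hA g1 gs; elim=> [|n IH] x hx; first exact: g1.
by rewrite pressure_sumS; apply: le_trans (gs _ hx); exact: transfer_le.
Qed.

Definition tail_digits m N : seq int :=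
  [seq (m + i.+1)%:Z | i <- iota 0 N] ++ [seq - (m + i.+1)%:Z | i <- iota 0 N].

Lemma mem_tail_digits m N b :
  (b \in tail_digits m N) = ((m < `|b|)%N && (`|b| <= m + N)%N).
Proof.
rewrite mem_cat; apply/orP/andP => [[] /mapP[i]|[]].
- by rewrite mem_iota => h ->; split; lia.
- by rewrite mem_iota => h ->; split; lia.
case: (leP 0 b) => hb h1 h2; [left|right]; apply/mapP;
  by exists (`|b| - m.+1)%N; rewrite ?mem_iota; lia.
Qed.

Lemma uniq_tail_digits m N : uniq (tail_digits m N).
Proof.
rewrite cat_uniq !map_inj_uniq ?iota_uniq/= ?andbT; first 1 last.
- by move=> i j; lia.
- by move=> i j; lia.
by apply/hasPn => b /mapP[i _ ->]; apply/mapP => -[j _]; lia.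
Qed.

Lemma digits_tail m N : (1 < m)%N -> digits (tail_digits m N).
Proof. by move=> hm b; rewrite mem_tail_digits /nicf_alphabet/=; lia. Qed.

Lemma transfer_tail_digits s m N f x : transfer s (tail_digits m N) f x =
  \sum_(i < N) ((phi (m + i.+1)%:Z x ^+ 2) `^ s * f (phi (m + i.+1)%:Z x) +
    (phi (- (m + i.+1)%:Z) x ^+ 2) `^ s * f (phi (- (m + i.+1)%:Z) x)).
Proof.
by rewrite transfer_cat /transfer !big_map big_split/=
  -[in LHS](subn0 N) -/(index_iota 0 N) !big_mkord.
Qed.

Lemma telescope_inv (u : R) N : 0 < u ->
  \sum_(i < N) ((u + i%:R)^-1 - (u + i.+1%:R)^-1) = u^-1 - (u + N%:R)^-1.
Proof.
move=> u0; elim: N => [|N IH]; first by rewrite big_ord0 addr0 subrr.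
by rewrite big_ord_recr/= IH; ring.
Qed.

(** The right side, the integral of v^-2 over the unit interval centred at u, equals (u^2 -
    1/4)^-1. *)
Lemma sqr_inv_le_telescope (u : R) : 1 < u ->
  u ^- 2 <= (u - 2^-1)^-1 - (u + 2^-1)^-1.
Proof.
move=> u1; have -> : (u - 2^-1)^-1 - (u + 2^-1)^-1 = (u ^+ 2 - 4^-1)^-1.
  by field; apply/andP; split; [|apply/andP; split]; rewrite gt_eqF//; nra.
by rewrite lef_pV2 ?posrE//; nra.
Qed.

(** The positive digits telescope to at most (5/2 + x)^-1 and the negative ones to at most (5/2 -
    x)^-1; each is at most 1/2. *)
Lemma transfer1_tail_le1 N x : inX x -> transfer 1 (tail_digits 2 N) (fun=> 1) x <= 1.
Proof.
move=> hx; have {hx} /andP[x1 x2] : - 2^-1 <= x <= 2^-1 by rewrite -ler_norml.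
rewrite transfer_tail_digits.
apply: (@le_trans _ _ (\sum_(i < N) ((((5/2 + x) + i%:R)^-1 - ((5/2 + x) + i.+1%:R)^-1)
   + (((5/2 - x) + i%:R)^-1 - ((5/2 - x) + i.+1%:R)^-1)))).
  apply: ler_sum => i _; rewrite !powRr1 ?sqr_ge0// !mulr1.
  have i0 : 0 <= i%:R :> R by [].
  rewrite /nicf_map !exprVn; apply: lerD.
    apply: le_trans (sqr_inv_le_telescope _) _.
      by rewrite -pmulrn natrD -[i.+1]addn1 natrD; lra.
    by rewrite -pmulrn natrD -[i.+1]addn1 natrD le_eqVlt; apply/orP; left; apply/eqP;
      congr (_^-1 - _^-1); field.
  rewrite mulrNz -[X in X ^- 2]opprK sqrrN.
  apply: le_trans (sqr_inv_le_telescope _) _.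
    by rewrite -pmulrn natrD -[i.+1]addn1 natrD; lra.
  by rewrite -pmulrn natrD -[i.+1]addn1 natrD le_eqVlt; apply/orP; left; apply/eqP;
      congr (_^-1 - _^-1); field.
rewrite big_split/= !telescope_inv; [|lra|lra].
have h1 : 0 <= (5/2 + x + N%:R)^-1 by rewrite invr_ge0 addr_ge0//; lra.
have h2 : 0 <= (5/2 - x + N%:R)^-1 by rewrite invr_ge0 addr_ge0//; lra.
have h3 : (5/2 + x)^-1 <= 2^-1 by rewrite lef_pV2 ?posrE; lra.
have h4 : (5/2 - x)^-1 <= 2^-1 by rewrite lef_pV2 ?posrE; lra.
lra.
Qed.

Definition subcritical s (G : set int) := forall A, uniq A ->
  (forall b, b \in A -> G b) -> forall n x, inX x -> pressure_sum s A n x <= 9 / 4.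

(** The constant 1 is a supersolution for exponent 1. This bounds the dimension of the full system
    by 1, so that the theorem only concerns t <= 1. *)
Lemma subcritical1 : subcritical 1 nicf_alphabet.
Proof.
move=> A uA hA n x hx.
pose N := (\max_(b <- A) `|b|)%N.
have AT : {subset A <= tail_digits 2 N}.
  move=> b bA; rewrite mem_tail_digits; have := hA b bA; rewrite /nicf_alphabet/=.
  have : (`|b| <= N)%N by rewrite /N; apply: (@leq_bigmax_seq _ _ xpredT (fun b : int => `|b|%N)).
  by move=> h1 h2; apply/andP; split; lia.
apply: le_trans (pressure_sum_sub 1 n uA AT (@digits_tail 2 N isT) hx) _.
apply: (@le_trans _ _ 1); last by lra.
apply: (@pressure_sum_supersolution 1 _ (fun=> 1) (@digits_tail 2 N isT)) => // y hy.
exact: transfer1_tail_le1.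
Qed.

(** Pairing k with -k removes the dependence on x: by the inequality of means the sum is at least 2
    / (k^2 - x^2), and k^2 - x^2 <= k (k + 1). The bound then telescopes in k. *)
Lemma sqr_inv_convex (k x : R) : 1 <= k -> inX x ->
  2 * (k^-1 - (k + 1)^-1) <= (k + x) ^- 2 + (- k + x) ^- 2.
Proof.
move=> k1 hx; have {hx} /andP[x1 x2] : - 2^-1 <= x <= 2^-1 by rewrite -ler_norml.
have -> : - k + x = - (k - x) by ring.
rewrite sqrrN.
have h : 2 * (k * (k + 1))^-1 = 2 * (k^-1 - (k + 1)^-1).
  by field; apply/andP; split; rewrite gt_eqF//; lra.
rewrite -h.
have kx : 0 < k + x by lra.
have kx' : 0 < k - x by lra.
rewrite -!exprVn.
have amgm (u v : R) : 2 * (u * v) <= u ^+ 2 + v ^+ 2 by have := sqr_ge0 (u - v); lra.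
apply: le_trans (amgm _ _).
by rewrite ler_pM2l// -invfM lef_pV2 ?posrE ?mulr_gt0//; [nra|lra|lra].
Qed.

(** For larger digits k the ratio of derivatives |phi_k'| / |phi_b'| is at most 1, so its s-th power
    is at least the ratio itself. This reduces the claim to exponent 1, with a loss of 4/9 for the
    variation of f. *)
Lemma tail_dominates s b f x : 0 <= s <= 1 -> nicf_alphabet b -> inX x ->
  (forall y z, inX y -> inX z -> f y <= 9 / 4 * f z) -> (forall y, 0 <= f y) ->
  (phi b x ^+ 2) `^ s * f (phi b x) <=
    transfer s (tail_digits `|b| (9 * `|b|.+1)) f x.
Proof.
move=> /andP[s0 s1] hb hx hf f0; set m := `|b|%N.
have m3 : (3 <= m)%N by move: hb; rewrite /nicf_alphabet/=; lia.
have m3R : 3 <= m%:R :> R by rewrite (ler_nat _ 3 m).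
have bm : `|b%:~R| = m%:R :> R by rewrite -intr_norm /m pmulrn abszE.
pose q := phi b x ^+ 2.
have qge : 0 < q by rewrite exprn_even_gt0//= invr_eq0 digit_addr_neq0.
have q0 := ltW qge.
have qle : (m%:R - 2^-1) ^+ 2 <= q^-1.
  rewrite /q -exprVn invrK -[leRHS]real_normK ?num_real//.
  rewrite ler_sqr ?nnegrE//; last lra.
  by have := lerB_normD b%:~R x; rewrite bm; lra.
have step k : nicf_alphabet k -> (m < `|k|)%N ->
    4 / 9 * f (phi b x) * (q `^ s * (q^-1 * phi k x ^+ 2)) <=
    (phi k x ^+ 2) `^ s * f (phi k x).
  move=> hk mk; rewrite mulrC; apply: ler_pM.
  - by rewrite (mulr_ge0 (powR_ge0 _ _))// mulr_ge0 ?invr_ge0 ?sqr_ge0.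
  - by rewrite mulr_ge0//; lra.
  - rewrite -[in leRHS](mulVKf (lt0r_neq0 qge) (phi k x ^+ 2)).
    rewrite (powRM _ q0) ?(mulr_ge0 _ (sqr_ge0 _)) ?invr_ge0//.
    rewrite ler_wpM2l ?powR_ge0//. apply: ger1_powR => //.
    rewrite mulr_gt0 ?invr_gt0// ?exprn_even_gt0//= ?invr_eq0 ?digit_addr_neq0//=.
    rewrite ler_pdivrMl// mulr1 /q /nicf_map !exprVn.
    rewrite lef_pV2 ?posrE ?exprn_even_gt0//= ?digit_addr_neq0//.
    rewrite -(real_normK (num_real (b%:~R + x))) -(real_normK (num_real (k%:~R + x))).
    rewrite ler_sqr ?nnegrE//.
    have := ler_normD b%:~R x; have := lerB_normD k%:~R x.
    have : m%:R + 1 <= `|k%:~R| :> R by rewrite -intr_norm natr1 pmulrn ler_int; lia.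
    by rewrite bm; lra.
  - have h1 := hf _ _ (nicf_map_inX hb hx) (nicf_map_inX hk hx).
    by lra.
rewrite transfer_tail_digits -/m.
have hd i : nicf_alphabet (m + i.+1)%:Z /\ nicf_alphabet (- (m + i.+1)%:Z).
  by rewrite /nicf_alphabet/=; split; lia.
apply: (@le_trans _ _ (\sum_(i < 9 * m.+1) (4 / 9 * f (phi b x) * (q `^ s * q^-1)) *
    (2 * ((m.+1%:R + i%:R)^-1 - (m.+1%:R + i.+1%:R)^-1)))); last first.
  apply: ler_sum => i _; have [h1 h2] := hd i.
  apply: le_trans (lerD (step _ h1 _) (step _ h2 _)); [|lia|lia].
  rewrite [leRHS](_ : _ = 4 / 9 * f (phi b x) * (q `^ s * q^-1) *
    (phi (m + i.+1)%:Z x ^+ 2 + phi (- (m + i.+1)%:Z) x ^+ 2)); last by ring.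
  rewrite ler_wpM2l//; first by rewrite mulr_ge0 ?mulr_ge0 ?powR_ge0 ?invr_ge0.
  have := @sqr_inv_convex (m + i.+1)%:R x _ hx.
  rewrite /nicf_map !exprVn mulrNz -pmulrn => h.
  apply: le_trans (h _).
    by rewrite le_eqVlt; apply/orP; left; apply/eqP; congr (2 * (_^-1 - _^-1));
      rewrite -?natrD ?natr1; congr (_%:R); lia.
  by rewrite ler1n; lia.
rewrite -mulr_sumr -mulr_sumr telescope_inv//.
(* The tail ends at m + 9 (m + 1), so that the telescoped sum runs from 1 / (m + 1) down to 1 / (10
   (m + 1)). *)
have -> : m.+1%:R^-1 - (m.+1%:R + (9 * m.+1)%:R)^-1 = 9 / 10 * (m%:R + 1)^-1 :> R.
  by rewrite natrM -[m.+1]addn1 natrD; field; apply/andP; split; rewrite gt_eqF//; lra.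
set F := f (phi b x); have F0 : 0 <= F by exact: f0.
have -> : 4 / 9 * F * (q `^ s / q) * (2 * (9 / 10 / (m%:R + 1))) =
  (q `^ s * F) * (4 / 5 * q^-1 / (m%:R + 1)) by field; rewrite !gt_eqF//; lra.
rewrite -[leLHS]mulr1 ler_wpM2l ?mulr_ge0 ?powR_ge0//.
(* What remains follows from (4/5) (m - 1/2)^2 >= m + 1, true from m = 3 on. *)
rewrite ler_pdivlMr; last lra.
nra.
Qed.

(** [tail_dominates] is applied with f the pressure sum of [b :: A], whose distortion is at most
    9/4; monotonicity of the operator of [A ++ T] then closes the induction. *)
Lemma pressure_sum_replace s b A T : 0 <= s <= 1 -> nicf_alphabet b -> digits A ->
  digits T -> {subset tail_digits `|b| (9 * `|b|.+1) <= T} ->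
  forall n x, inX x -> pressure_sum s (b :: A) n x <= pressure_sum s (A ++ T) n x.
Proof.
move=> hs hb hA hT sub.
have hAT : digits (A ++ T) by move=> c; rewrite mem_cat => /orP[/hA|/hT].
have hbA : digits (b :: A) by move=> c; rewrite inE => /orP[/eqP->|/hA].
elim=> [//|n IH] x hx; rewrite !pressure_sumS.
apply: (@le_trans _ _ (transfer s (A ++ T) (pressure_sum s (b :: A) n) x)); last exact: transfer_le.
rewrite transfer_cons transfer_cat addrC lerD2l.
apply: le_trans (transfer_sub _ _ (uniq_tail_digits _ _) sub _).
  apply: tail_dominates => // [y z hy hz|y]; first exact: pressure_sum_distortion.
  exact: pressure_sum_ge0.
by move=> y; exact: pressure_sum_ge0.
Qed.

(** * Adding a large digit *)

Lemma sqr_powR_decay s t : 0 <= s -> s < t ->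
  exists rho : R, [/\ 0 <= rho, rho < 1 &
    forall y, `|y| <= 2 / 5 -> (y ^+ 2) `^ t <= rho * (y ^+ 2) `^ s].
Proof.
move=> s0 st; exists ((4 / 25) `^ (t - s)); split; first exact: powR_ge0.
  rewrite [ltRHS](_ : _ = 1 `^ (t - s)); last by rewrite powR1.
  by apply: gt0_ltr_powR; rewrite ?nnegrE; lra.
move=> y hy; have -> : t = s + (t - s) by ring.
have t0 : s + (t - s) != 0 by rewrite gt_eqF//; lra.
rewrite powRD ?(negbTE t0)// mulrC ler_wpM2r ?powR_ge0//.
rewrite (_ : s + (t - s) - s = t - s); last by ring.
apply: ge0_ler_powR; rewrite ?nnegrE ?sqr_ge0//; [lra|].
rewrite -[leLHS]real_normK ?num_real// (_ : 4 / 25 = (2 / 5) ^+ 2); last by field.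
by rewrite ler_sqr ?nnegrE//; lra.
Qed.

Lemma subcritical_le s (G G' : set int) : G' `<=` G ->
  subcritical s G -> subcritical s G'.
Proof. by move=> sub h A uA hA; apply: h => // b /hA; apply: sub. Qed.

(** Raising the exponent from s to t turns the bound 9/4 into rho^n * 9/4 with rho < 1. The point is
    that N does not depend on the finite subset A. *)
Lemma subcritical_bound_decay s t (G : set int) e : G `<=` nicf_alphabet -> 0 <= s ->
  s < t -> subcritical s G -> 0 < e ->
  exists2 N, (0 < N)%N & forall A, uniq A -> (forall b, b \in A -> G b) ->
    (forall n x, (N <= n)%N -> inX x -> pressure_sum t A n x <= e) /\
    (forall n x, inX x -> pressure_sum t A n x <= 9 / 4).
Proof.
move=> GF s0 st hG e0; have [rho [rho0 rho1 hrho]] := sqr_powR_decay s0 st.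
have [N hN] : exists n, rho ^+ n < e * (4 / 9).
  by apply: small_expr => //; rewrite mulr_gt0//; lra.
exists N.+1 => // A uA hA; have dA : digits A by move=> b /hA /GF.
have hle n x : inX x -> pressure_sum t A n x <= rho ^+ n * (9 / 4).
  move=> hx; apply: le_trans (pressure_sum_le_exponent n dA hrho rho0 hx) _.
  by rewrite ler_wpM2l ?exprn_ge0//; exact: hG.
split=> [n x Nn hx|n x hx].
  apply: le_trans (hle _ _ hx) _.
  have : rho ^+ n <= rho ^+ N by apply: ler_wiXn2l => //; [exact: ltW|exact: ltnW].
  by lra.
apply: le_trans (hle _ _ hx) _.
by rewrite ler_piMl ?exprn_ile1 ?(ltW rho1)//; lra.
Qed.

(** Take N with L^N 1 <= 1/2 and g the sum of the L^k 1 for k < N: then L g <= g - 1/2. A digit so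
    large that it contributes at most 1/2 keeps g a supersolution, so the pressure sums stay below
    M, and the bootstrap improves M to 9/4. *)
Lemma subcritical_add_digit s t (G : set int) : G `<=` nicf_alphabet -> 0 <= s ->
  s < t -> t <= 1 -> subcritical s G ->
  exists E : R, forall b, nicf_alphabet b -> E <= `|b%:~R| ->
    subcritical t (G `|` [set b]).
Proof.
move=> GF s0 st t1 hG.
have [|N N0 hN] := @subcritical_bound_decay s t G 2^-1 GF s0 st hG; first by lra.
have t0 : 0 < t by lra.
pose M : R := N%:R * (9 / 4).
have M0 : 0 < M by rewrite mulr_gt0 ?ltr0n//; lra.
pose d := ((2 * M)^-1) `^ (t^-1).
have d0 : 0 < d by rewrite powR_gt0// invr_gt0; lra.
(* If |b| >= d^-1 + 1 then |b + y| >= d^-1, so |phi_b'(y)| <= |phi_b(y)| <= d and its t-th power is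
   at most 1 / (2 M). *)
exists (d^-1 + 1) => b hb hE A uA hA.
pose A' := [seq a <- A | a != b].
have uA' : uniq A' by rewrite filter_uniq.
have hA' c : c \in A' -> G c.
  by rewrite mem_filter => /andP[/eqP cb /hA[//|/cb]].
have dA' : digits A' by move=> c /hA' /GF.
have dbA' : digits (b :: A') by move=> c; rewrite inE => /orP[/eqP->|/dA'].
have [hN1 hN2] := hN A' uA' hA'.
pose g y := \sum_(k < N) pressure_sum t A' k y.
have gM y : inX y -> g y <= M.
  move=> hy; apply: (@le_trans _ _ (\sum_(k < N) (9 / 4 : R))).
    by apply: ler_sum => k _; exact: hN2.
  by rewrite sumr_const card_ord /M -[leLHS]mulr_natl.
have g1 y : inX y -> 1 <= g y.
  move=> hy; rewrite /g; case: (N) N0 => // K _.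
  by rewrite big_ord_recl (_ : pressure_sum t A' ord0 y = 1)// lerDl
    sumr_ge0// => k _; exact: pressure_sum_ge0.
have AA' : {subset A <= b :: A'}.
  by move=> c cA; rewrite inE mem_filter cA andbT orbN.
apply: (@pressure_sum_bootstrap _ _ M) => [|c /hA[/GF//|->//]|n x hx].
  by apply/andP; split; lra.
apply: le_trans (pressure_sum_sub t n uA AA' dbA' hx) _.
apply: le_trans (gM _ hx).
apply: pressure_sum_supersolution => // y hy.
rewrite transfer_cons transfer_sum_pressure -/(g y).
have := hN1 N y (leqnn N) hy.
have small : (phi b y ^+ 2) `^ t <= (2 * M)^-1.
  rewrite -[leRHS]powRr1 ?invr_ge0; last by lra.
  rewrite -[X in _ <= _ `^ X](mulVf (lt0r_neq0 t0)) powRrM -/d.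
  apply: ge0_ler_powR; rewrite ?nnegrE ?sqr_ge0 ?powR_ge0//; first exact: ltW.
  rewrite /nicf_map exprVn -[leRHS]invrK lef_pV2 ?posrE ?invr_gt0//; last first.
    by rewrite exprn_even_gt0//= digit_addr_neq0.
  rewrite -(real_normK (num_real (b%:~R + y))).
  have := lerB_normD b%:~R y; have := digit_addr_ge hb hy.
  set u := `|_ + _| => h1 h2.
  have h3 : u <= u ^+ 2 by rewrite expr2 ler_peMl; lra.
  by lra.
have : (phi b y ^+ 2) `^ t * g (phi b y) <= (2 * M)^-1 * M.
  apply: ler_pM => //; first exact: powR_ge0.
    by apply: le_trans (g1 _ _); [lra|exact: nicf_map_inX].
  by apply: gM; exact: nicf_map_inX.
have -> : (2 * M)^-1 * M = 2^-1 by field; rewrite gt_eqF.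
lra.
Qed.

(** * Inverse branches of words *)

(* For a word u with continuants q_n these are phi_u, |phi_u'(0)| = q_n^-2 and
   q_(n-1) / q_n; adding a letter to u updates them without the numerators. *)
Record branch := Branch { branch_map : R -> R; branch_size : R; branch_ratio : R }.
Implicit Type p : branch.

Definition branch0 := Branch id 1 0.
Definition branch_step p b := Branch (branch_map p \o phi b)
  (branch_size p * phi b (branch_ratio p) ^+ 2) (phi b (branch_ratio p)).

(** The last clause is the exact distance formula for the Moebius map x |-> (p_n + p_(n-1) x) / (q_n
    + q_(n-1) x), whose determinant is 1 or -1. *)
Definition branch_valid p :=
  [/\ 0 < branch_size p, `|branch_ratio p| <= 2 / 5 &
   forall x y, inX x -> inX y -> `|branch_map p x - branch_map p y| =
     branch_size p * `|x - y| / ((1 + branch_ratio p * x) * (1 + branch_ratio p * y))].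

Lemma branch_valid0 : branch_valid branch0.
Proof.
split=> //=; first by rewrite normr0; lra.
by move=> x y _ _; rewrite !mul0r !addr0 !mul1r invr1 mulr1.
Qed.

Lemma branch_valid_step p b : nicf_alphabet b -> branch_valid p ->
  branch_valid (branch_step p b).
Proof.
move=> hb [D0 r25 hd].
have hr : inX (branch_ratio p) by lra.
have br0 := digit_addr_neq0 hb hr.
split=> /=.
- by rewrite mulr_gt0// exprn_even_gt0//= invr_eq0.
- exact: nicf_map_le.
move=> x y hx hy; rewrite hd ?nicf_map_inX//.
have bx0 := digit_addr_neq0 hb hx; have by0 := digit_addr_neq0 hb hy.
have -> : phi b x - phi b y = (y - x) * (phi b x * phi b y).
  by rewrite /nicf_map; field; rewrite bx0 by0.
have r'25 := nicf_map_le hb hr.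
set r' := phi b (branch_ratio p) in r'25 *; set q := branch_ratio p in hr br0 r25 r' r'25 *.
have upos z : inX z -> 0 < 1 + q * phi b z.
  by move=> hz; have := inX_mul_itv r25 (nicf_map_inX hb hz); lra.
have vpos z : inX z -> 0 < 1 + r' * z.
  by move=> hz; have := inX_mul_itv r'25 hz; lra.
(* The identity of [nicf_map_kernel] before squaring: (b + z)(1 + q phi_b(z)) = (b + q)(1 + r'
   z). *)
have E z : inX z -> phi b z = r' * ((1 + q * phi b z) / (1 + r' * z)).
  move=> hz; have bz0 := digit_addr_neq0 hb hz.
  rewrite mulrA; apply/(canRL (mulfK (lt0r_neq0 (vpos z hz)))).
  by rewrite /r' /nicf_map; field; rewrite bz0 br0.
have key : phi b x * phi b y = r' ^+ 2 *
    ((1 + q * phi b x) * (1 + q * phi b y) / ((1 + r' * x) * (1 + r' * y))).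
  by rewrite [in LHS](E x hx) [in LHS](E y hy) invfM; ring.
have ux := upos x hx; have uy := upos y hy; have vx := vpos x hx; have vy := vpos y hy.
move: key ux uy vx vy; set ax := 1 + q * phi b x; set ay := 1 + q * phi b y.
move=> -> ux uy vx vy; rewrite normrM distrC.
rewrite [X in _ * (_ * X) / _]ger0_norm; last first.
  by rewrite mulr_ge0 ?sqr_ge0// ltW// divr_gt0 ?mulr_gt0.
by field; rewrite !gt_eqF.
Qed.

(** The two factors of the denominator lie in [4/5, 6/5]. *)
Lemma branch_map_dist p x y : branch_valid p -> inX x -> inX y ->
  25 / 36 * branch_size p * `|x - y| <= `|branch_map p x - branch_map p y|
    <= 25 / 16 * branch_size p * `|x - y|.
Proof.
move=> [D0 r25 hd] hx hy; rewrite hd//.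
have /andP[u1 u2] := inX_mul_itv r25 hx; have /andP[v1 v2] := inX_mul_itv r25 hy.
move: u1 u2 v1 v2; set u := 1 + _; set v := 1 + _ => u1 u2 v1 v2.
have uv0 : 0 < u * v by rewrite mulr_gt0//; lra.
have e0 : 0 <= branch_size p * `|x - y| by rewrite mulr_ge0// ltW.
rewrite ler_pdivlMr// ler_pdivrMr// -!mulrA.
move: e0; rewrite !mulrA; set e := _ * `|_| => e0.
have h1 : u * v <= 36 / 25 by nra.
have h2 : 16 / 25 <= u * v by nra.
apply/andP; split.
  have -> : 25 / 36 * branch_size p * `|x - y| * u * v = e * (25 / 36 * (u * v)) by rewrite /e; ring.
  by rewrite -[leRHS]mulr1 ler_wpM2l//; lra.
have -> : 25 / 16 * branch_size p * `|x - y| * u * v = e * (25 / 16 * (u * v)) by rewrite /e; ring.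
by rewrite -[leLHS]mulr1 ler_wpM2l//; lra.
Qed.

Definition branch_of (u : seq int) := foldl branch_step branch0 u.

Lemma branch_of_rcons u b : branch_of (rcons u b) = branch_step (branch_of u) b.
Proof. by rewrite /branch_of foldl_rcons. Qed.

Lemma branch_of_mkseqS w n :
  branch_of (mkseq w n.+1) = branch_step (branch_of (mkseq w n)) (w n).
Proof. by rewrite mkseqS branch_of_rcons. Qed.

Lemma branch_map_mkseq w n : branch_map (branch_of (mkseq w n)) = ifs_comp phi w n.
Proof. by elim: n => [//|n IH]; rewrite branch_of_mkseqS /= IH. Qed.

Lemma branch_of_valid u : digits u -> branch_valid (branch_of u).
Proof.
elim/last_ind: u => [_|u b IH hu]; first exact: branch_valid0.
rewrite branch_of_rcons; apply: branch_valid_step.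
  by apply: hu; rewrite mem_rcons mem_head.
by apply: IH => c cu; apply: hu; rewrite mem_rcons inE cu orbT.
Qed.

Lemma branch_step_size p b : nicf_alphabet b -> branch_valid p ->
  branch_size (branch_step p b) <= branch_size p * (4 / 25).
Proof.
move=> hb [D0 r25 _] /=; rewrite (ler_wpM2l (ltW D0))//.
have hr : inX (branch_ratio p) by lra.
rewrite -(real_normK (num_real (phi b (branch_ratio p)))) (_ : 4 / 25 = (2 / 5) ^+ 2); last by field.
by rewrite ler_sqr ?nnegrE//; exact: nicf_map_le.
Qed.

Lemma branch_of_size u : digits u -> branch_size (branch_of u) <= (4 / 25) ^+ size u.
Proof.
elim/last_ind: u => [_|u b IH hu]; first by rewrite expr0.
have hb : nicf_alphabet b by apply: hu; rewrite mem_rcons mem_head.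
have hu' : digits u by move=> c cu; apply: hu; rewrite mem_rcons inE cu orbT.
rewrite branch_of_rcons size_rcons exprSr.
apply: le_trans (branch_step_size hb (branch_of_valid hu')) _.
by rewrite ler_wpM2r ?IH//; lra.
Qed.

Lemma digits_mkseq w n : (forall n, nicf_alphabet (w n)) -> digits (mkseq w n).
Proof. by move=> hw b /mapP[i _ ->]; exact: hw. Qed.

Lemma ifs_comp_continuous w n x : (forall n, nicf_alphabet (w n)) -> inX x ->
  {for x, continuous (ifs_comp phi w n)}.
Proof.
move=> hw; elim: n x => [|n IH] x hx /=; first exact: cvg_id.
apply: continuous_comp; last exact/IH/nicf_map_inX.
rewrite /nicf_map; apply: cvgV; first exact: digit_addr_neq0.
by apply: cvgD; [exact: cvg_cst|exact: cvg_id].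
Qed.

Lemma ifs_comp_subset w m n : (forall n, nicf_alphabet (w n)) -> (m <= n)%N ->
  ifs_comp phi w n @` `[- (2 / 5), 2 / 5] `<=` ifs_comp phi w m @` `[- (2 / 5), 2 / 5].
Proof.
move=> hw mn; rewrite -(subnK mn); elim: (n - m)%N => [//|k IH].
apply: subset_trans IH => _ [y hy <-] /=.
exists (phi (w (k + m)%N) y) => //.
have {}hy : `|y| <= 2 / 5 by move: hy; rewrite /= in_itv/= ler_norml.
rewrite /= in_itv/= -ler_norml; apply: nicf_map_le => //.
by lra.
Qed.

(** The point is a cluster point of the images of 0, by compactness. Locating it in the images of
    the smaller interval [-2/5, 2/5] matters later: cylinders over that interval are separated,
    whereas those over [-1/2, 1/2] may touch. *)
Lemma nicf_code_exists w : (forall n, nicf_alphabet (w n)) ->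
  exists x, ifs_code phi `[- 2^-1, 2^-1] w x /\
    forall n, exists2 y, `|y| <= 2 / 5 & branch_map (branch_of (mkseq w n)) y = x.
Proof.
move=> hw; pose Y : set R := `[- (2 / 5), 2 / 5]%classic.
have Ycpt : compact Y by exact: segment_compact.
have Y0 : Y 0 by rewrite /Y/= in_itv/= ; apply/andP; split; lra.
have YX : Y `<=` `[- 2^-1, 2^-1] by move=> y; rewrite /Y/= !in_itv/= => /andP[? ?];
  apply/andP; split; lra.
have cl n : closed (ifs_comp phi w n @` Y).
  apply: compact_closed; first exact: Rhausdorff.
  apply: continuous_compact => //; apply: continuous_in_subspaceT => y.
  rewrite inE => /YX; rewrite /= in_itv/= -ler_norml => hy.
  exact: ifs_comp_continuous.
pose z n := ifs_comp phi w n 0.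
have zn n : (z @ \oo) (ifs_comp phi w n @` Y).
  exists n => // m /= nm; apply: (ifs_comp_subset hw nm).
  by exists 0.
have zY : (z @ \oo) Y by have := zn 0%N; rewrite /= image_id.
have [x [_ hx]] := Ycpt (z @ \oo) _ zY.
have hxn n : (ifs_comp phi w n @` Y) x.
  by apply: (cl n) => B hB; exact: hx.
exists x; split; last first.
  move=> n; have [y hy yx] := hxn n; exists y; last by rewrite branch_map_mkseq.
  by move: hy; rewrite /Y/= in_itv/= ler_norml.
apply/seteqP; split => [y hy|_ -> n _]; last first.
  by have [u hu <-] := hxn n; exists u => //; exact: YX.
apply/eqP; rewrite -subr_eq0 -normr_eq0 eq_le normr_ge0 andbT leNgt; apply/negP => d0.
(* Two points of the intersection are at distance at most 25/16 * (4/25)^n. *)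
have [|||n hn] := @small_expr (4 / 25) (`|y - x| * (16 / 25)); [lra|lra|lra|].
have [u + yu] := hy n.+1 isT; have [v + xv] := hxn n.+1.
move=> /YX; rewrite /= !in_itv/= -!ler_norml => hv hu.
have du := @digits_mkseq w n.+1 hw.
have /andP[_] := branch_map_dist (branch_of_valid du) hu hv.
rewrite branch_map_mkseq yu xv leNgt => /negP; apply.
have := branch_of_size du; rewrite size_mkseq.
have [D0 _ _] := branch_of_valid du.
move: D0; set D := branch_size _ => D0 hD.
have h : `|u - v| <= 1.
  by have := ler_normB u v; lra.
have h2 : (4 / 25) ^+ n.+1 <= (4 / 25) ^+ n :> R.
  by rewrite exprS ler_piMl ?exprn_ge0//; lra.
have h3 : D * `|u - v| <= D by rewrite ler_piMr// ltW.
by rewrite -mulrA; lra.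
Qed.

(** * Upper bounds for the dimension *)

Lemma diam_le (A : set R) (d : R) : (forall x y, A x -> A y -> `|x - y| <= d) ->
  (diam A <= d%:E)%E.
Proof.
by move=> h; apply: ge_ereal_sup => _ [x Ax [y Ay <-]]; rewrite lee_fin; exact: h.
Qed.

Lemma diam_pow_ge0 s (A : set R) : (0 <= diam_pow s A)%E.
Proof. by rewrite /diam_pow; case: ifP => // _; exact: poweR_ge0. Qed.

Lemma diam_fin (A : set R) (d : R) x : A x -> (diam A <= d%:E)%E ->
  exists2 e, diam A = e%:E & 0 <= e <= d.
Proof.
move=> Ax Ad.
have d0 : (0%:E <= diam A)%E.
  by apply: ereal_sup_ubound; exists x => //; exists x => //; rewrite subrr normr0.
move: Ad d0; case: (diam A) => [e| |]//.
by rewrite !lee_fin => h1 h2; exists e => //; apply/andP.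
Qed.

Lemma diam_pow_le s (A : set R) (d : R) : 0 <= s -> 0 <= d ->
  (diam A <= d%:E)%E -> (diam_pow s A <= (d `^ s)%:E)%E.
Proof.
move=> s0 d0 Ad; rewrite /diam_pow; case: ifPn => [_|/set0P[x Ax]].
  by rewrite lee_fin powR_ge0.
have [e -> /andP[e0 ed]] := diam_fin Ax Ad.
by rewrite poweR_EFin lee_fin ge0_ler_powR ?nnegrE.
Qed.

Lemma nneseries_pickle_le (I : countType) (f : I -> \bar R) (M : \bar R) :
  (forall i, (0 <= f i)%E) ->
  (forall l, uniq l -> (\sum_(i <- l) f i <= M)%E) ->
  (\sum_(0 <= n <oo) oapp f 0%E (pickle_inv n : option I) <= M)%E.
Proof.
move=> f0 hM; apply: lime_le.
  by apply: is_cvg_nneseries => n _ _; case: (pickle_inv n) => [i|]/=.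
near=> n; rewrite /index_iota subn0.
have -> : (\sum_(k <- iota 0 n) oapp f 0 (pickle_inv k : option I) =
    \sum_(i <- pmap (pickle_inv : nat -> option I) (iota 0 n)) f i)%E.
  elim: (iota 0 n) => [|k l IH]; first by rewrite !big_nil.
  by rewrite big_cons IH /=; case: (pickle_inv k) => [i|]/=; rewrite ?big_cons ?add0e.
apply: hM; apply: (pmap_uniq (@pickle_invK I)); exact: iota_uniq.
Unshelve. all: by end_near. Qed.

(** Allows covers indexed by words: the family is transported along [pickle_inv] and padded with
    empty sets, which cost 0. *)
Lemma hausdorff_premeasure_countable_cover (I : countType) (V : I -> set R) s delta M
    (A : set R) :
  A `<=` \bigcup_i V i -> (forall i, (diam (V i) <= delta%:E)%E) ->
  (forall l, uniq l -> (\sum_(i <- l) diam_pow s (V i) <= M)%E) ->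
  (hausdorff_premeasure s delta A <= M)%E.
Proof.
move=> AV hd hM.
pose U n := if (pickle_inv n : option I) is Some i then V i else set0.
apply: (@le_trans _ _ (\sum_(0 <= n <oo) diam_pow s (U n))%E).
  apply: ereal_inf_lbound; exists U => //; split.
    move=> x /AV[i _ Vx]; exists (pickle i) => //.
    by rewrite /U pickleK_inv.
  move=> n; rewrite /U; case: (pickle_inv n) => [i|]; first exact: hd.
  rewrite /diam (_ : [set _ | _ in _ & _ in _] = set0); first by rewrite ereal_sup0 leNye.
  by apply/seteqP; split => // y [].
have -> : (\sum_(0 <= n <oo) diam_pow s (U n) =
    \sum_(0 <= n <oo) oapp (fun i => diam_pow s (V i)) 0 (pickle_inv n : option I))%E.
  apply: eq_eseriesr => n _; rewrite /U; case: (pickle_inv n) => [i|]//=.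
  by rewrite /diam_pow eqxx.
by apply: nneseries_pickle_le => // i; exact: diam_pow_ge0.
Qed.

Fixpoint words A n : seq (seq int) :=
  if n is m.+1 then [seq b :: u | b <- A, u <- words A m] else [:: [::]].

Lemma mem_words A n u : (u \in words A n) = (size u == n) && all (mem A) u.
Proof.
elim: n u => [|n IH] [|b u]//=.
  by apply/allpairsP => -[[c v] []].
apply/allpairsP/idP => [[[c v] /= [cA]]|/and3P[su bA uA]].
  by rewrite IH => /andP[/eqP <- vA] [-> ->]; rewrite eqxx cA.
by exists (b, u); rewrite IH /= uA -eqSS su.
Qed.

(** At [branch0] this turns the cost of all cylinders of level n into L^n 1 evaluated at 0. *)
Lemma sum_words_size s A n p : digits A -> branch_valid p ->
  \sum_(u <- words A n) branch_size (foldl branch_step p u) `^ s =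
  branch_size p `^ s * pressure_sum s A n (branch_ratio p).
Proof.
move=> hA; elim: n p => [|n IH] p hp.
  by rewrite big_seq1 /= mulr1.
rewrite big_allpairs_dep pressure_sumS /transfer mulr_sumr !big_seq.
apply: eq_bigr => b /hA hb; rewrite /= IH; last exact: branch_valid_step.
by have [D0 _ _] := hp; rewrite /= powRM ?sqr_ge0// ?ltW// mulrA.
Qed.

Lemma hausdorff_premeasure_ge0 s delta (A : set R) : (0 <= hausdorff_premeasure s delta A)%E.
Proof.
apply: le_ereal_inf_tmp => _ [U _ <-]; apply: nneseries_ge0 => n _ _.
exact: diam_pow_ge0.
Qed.

Lemma hausdorff_measure_eq0 s (A : set R) :
  (forall delta e : R, 0 < delta -> 0 < e -> (hausdorff_premeasure s delta A <= e%:E)%E) ->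
  hausdorff_measure s A = 0%E.
Proof.
move=> h; apply/eqP; rewrite eq_le; apply/andP; split.
  apply: ge_ereal_sup => _ [d /= d0 <-]; apply/lee_addgt0Pr => e e0.
  by rewrite add0e; exact: h.
apply: (le_trans (hausdorff_premeasure_ge0 s 1 A)).
by apply: ereal_sup_ubound; exists 1 => //=; exact: ltr01.
Qed.

Lemma subcritical_hausdorff_measure s t (G : set int) : G `<=` nicf_alphabet -> 0 <= s ->
  s < t -> subcritical s G -> hausdorff_measure t (limit_set phi X G) = 0%E.
Proof.
move=> GF s0 st hG; apply: hausdorff_measure_eq0 => delta e delta0 e0.
have t0 : 0 < t by lra.
have c0 : 0 < (25 / 16) `^ t :> R by rewrite powR_gt0.
have [|N1 _ hN1] := @subcritical_bound_decay s t G (e / (25 / 16) `^ t) GF s0 st hG.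
  by rewrite divr_gt0.
have [|||N2 hN2] := @small_expr (4 / 25) (delta * (16 / 25)); [lra|lra|lra|].
(* [N1] makes the total cost small and [N2] the diameters. *)
pose n := (N1 + N2)%N.
pose good (u : seq int) := (size u == n) && all (fun b => `[< G b >]) u.
pose V u : set R := if good u then branch_map (branch_of u) @` X else set0.
have goodP u : good u -> digits u.
  by move=> /andP[_ /allP h] b /h /asboolP; exact: GF.
have Xin y : X y -> inX y by rewrite /= in_itv/= ler_norml.
have diamV u : good u -> (diam (V u) <= (25 / 16 * branch_size (branch_of u))%:E)%E.
  move=> gu; apply: diam_le => ? ?; rewrite /V gu => -[x /Xin hx <-] [y /Xin hy <-].
  have hv := branch_of_valid (goodP u gu).
  have /andP[_ h] := branch_map_dist hv hx hy.
  apply: le_trans h _; have [D0 _ _] := hv.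
  by rewrite ler_piMr ?mulr_ge0 ?(ltW D0)//; have := ler_normB x y; lra.
have set0d d : (diam (set0 : set R) <= d%:E)%E by exact: diam_le.
apply: (@hausdorff_premeasure_countable_cover _ V).
- move=> x [w hw hx]; exists (mkseq w n) => //.
  have gn : good (mkseq w n).
    rewrite /good size_mkseq eqxx/=; apply/allP => b /mapP[i _ ->].
    by apply/asboolP; exact: hw.
  (* The intersection starts at level 1, so level n + 1 is used and its last letter absorbed, which
     also covers n = 0. *)
  have : [set x] x by [].
  rewrite -hx => /(_ n.+1 isT)[y Xy <-].
  rewrite /V gn branch_map_mkseq /=; exists (phi (w n) y) => //.
  move: Xy => /= /Xin hy; rewrite in_itv/= -ler_norml.
  by apply: nicf_map_inX => //; exact: GF.
- move=> u; case: (boolP (good u)) => gu; last by rewrite /V (negbTE gu).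
  apply: le_trans (diamV u gu) _; rewrite lee_fin.
  have := branch_of_size (goodP u gu).
  have /andP[/eqP -> _] := gu.
  have : (4 / 25) ^+ n <= (4 / 25) ^+ N2 :> R.
    by apply: ler_wiXn2l; [lra|lra|rewrite leq_addl].
  by lra.
move=> l ul.
pose l' := [seq u <- l | good u].
(* G may be infinite, but a finite partial sum involves only the finitely many letters of its
   words. *)
pose A := undup (flatten l').
have hA b : b \in A -> G b.
  rewrite mem_undup => /flattenP[u]; rewrite mem_filter => /andP[/andP[_ /allP h] _] /h.
  by move=> /asboolP.
have dA : digits A by move=> b /hA /GF.
have sub : {subset l' <= words A n}.
  move=> u ul'; rewrite mem_words; move: (ul'); rewrite mem_filter => /andP[/andP[-> _] _] /=.
  by apply/allP => b bu; rewrite inE mem_undup; apply/flattenP; exists u.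
have -> : (\sum_(i <- l) diam_pow t (V i) = \sum_(i <- l') diam_pow t (V i))%E.
  rewrite big_filter [RHS]big_mkcond; apply: eq_bigr => u _.
  by rewrite /V; case: ifP => // _; rewrite /diam_pow eqxx.
apply: (@le_trans _ _ (\sum_(u <- l') ((25 / 16) `^ t * branch_size (branch_of u) `^ t)%:E)%E).
  rewrite !big_seq; apply: lee_sum => u; rewrite mem_filter => /andP[gu _].
  have [D0 _ _] := branch_of_valid (goodP u gu).
  rewrite -powRM ?(ltW D0)//; apply: diam_pow_le; rewrite ?(ltW t0)//; last exact: diamV.
  by rewrite mulr_ge0 ?(ltW D0).
rewrite sumEFin lee_fin -mulr_sumr.
rewrite -ler_pdivlMl// mulrC.
apply: (@le_trans _ _ (\sum_(u <- words A n) branch_size (branch_of u) `^ t)).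
  by apply: ler_sum_sub; rewrite ?filter_uniq// => u; exact: powR_ge0.
rewrite sum_words_size//; last exact: branch_valid0.
rewrite powR1 mul1r.
have [h _] := hN1 A (undup_uniq _) hA.
by apply: h; [exact: leq_addr|rewrite normr0 invr_ge0].
Qed.

Lemma subcritical_hausdorff_dim s (G : set int) : G `<=` nicf_alphabet -> 0 <= s ->
  subcritical s G -> (hausdorff_dim (limit_set phi X G) <= s%:E)%E.
Proof.
move=> GF s0 hG; apply/lee_addgt0Pr => e e0.
apply: ereal_inf_lbound; exists (s + e) => //=; split; first by rewrite addr_ge0// ltW.
by apply: (subcritical_hausdorff_measure GF s0 _ hG); lra.
Qed.

(** * Lower bounds for the dimension *)

(** The numerator c - b + (z - y) of the difference is at least 1 - 4/5 in absolute value, and both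
    denominators are bounded since A is finite. *)
Lemma nicf_map_separation A : digits A -> exists2 gap : R, 0 < gap &
  forall b c y z, b \in A -> c \in A -> b != c -> `|y| <= 2 / 5 -> `|z| <= 2 / 5 ->
  gap <= `|phi b y - phi c z|.
Proof.
move=> dA; pose m := (\max_(b <- A) `|b|)%N; pose K : R := m%:R + 1.
have K1 : 1 <= K by rewrite lerDr.
exists (5^-1 / K ^+ 2); first by rewrite divr_gt0 ?exprn_gt0//; lra.
move=> b c y z bA cA bc hy hz.
have y2 : inX y by lra.
have z2 : inX z by lra.
have by0 := digit_addr_neq0 (dA b bA) y2; have cz0 := digit_addr_neq0 (dA c cA) z2.
have hK d v : d \in A -> `|v| <= 2^-1 -> `|d%:~R + v| <= K.
  move=> dA' hv; have := ler_normD d%:~R v.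
  have : `|d%:~R| <= m%:R :> R.
    rewrite -intr_norm pmulrn ler_int -abszE lez_nat.
    exact: (@leq_bigmax_seq _ _ xpredT (fun b : int => `|b|%N)).
  by rewrite /K; lra.
have -> : phi b y - phi c z = (c%:~R - b%:~R + (z - y)) / ((b%:~R + y) * (c%:~R + z)).
  by rewrite /nicf_map; field; rewrite by0 cz0.
rewrite normrM normfV normrM; apply: ler_pM.
- by rewrite invr_ge0.
- by rewrite invr_ge0 sqr_ge0.
- have : 1 <= `|c%:~R - b%:~R| :> R.
    rewrite -intrB -intr_norm -[leLHS]/(1%:~R) ler_int.
    by move: bc; lia.
  by have := lerB_normD (c%:~R - b%:~R) (z - y); have := ler_normB z y; lra.
rewrite lef_pV2 ?posrE ?mulr_gt0 ?normr_gt0 ?exprn_gt0//; [|lra..].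
by rewrite expr2 ler_pM// hK.
Qed.

Section Descent.
Variables (s : R) (A : seq int) (h : R -> R) (a : nat -> R) (U : nat -> set R) (M gap : R).
Hypotheses (s0 : 0 < s) (dA : digits A) (uA : uniq A).
Hypothesis gap0 : 0 < gap.
Hypothesis gapP : forall b c y z, b \in A -> c \in A -> b != c ->
  `|y| <= 2 / 5 -> `|z| <= 2 / 5 -> gap <= `|phi b y - phi c z|.
Hypothesis hM : forall x, inX x -> h x <= M.
Hypothesis M0 : 0 < M.
Hypothesis hsub : forall x, inX x -> h x <= transfer s A h x.
Hypothesis a0 : forall i, 0 < a i.
Hypothesis aU : forall i x y, U i x -> U i y -> `|x - y| `^ s <= a i.

(** Normalised so that, h being at most M, a cheap branch costs less than the s-th power of the
    distance between any two of its children. *)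
Let c := (25 / 36 * gap) `^ s / M.

Definition meets (p : branch) i := exists2 y, `|y| <= 2 / 5 & U i (branch_map p y).

Definition cost (p : branch) : \bar R :=
  (\sum_(0 <= i <oo) (if `[< meets p i >] then a i else 0)%:E)%E.

Definition cheap (p : branch) := branch_valid p /\
  (cost p < (c * branch_size p `^ s * h (branch_ratio p))%:E)%E.

Let term_ge0 p i : (0 <= (if `[< meets p i >] then a i else 0)%:E)%E.
Proof. by rewrite lee_fin; case: ifP => // _; exact: ltW. Qed.

Lemma cost_ge p i : meets p i -> ((a i)%:E <= cost p)%E.
Proof.
move=> /asboolP pi; rewrite /cost (nneseriesD1 (n := i))//.
by rewrite pi leeDl// nneseries_ge0.
Qed.

Lemma meets_step p b i : b \in A -> meets (branch_step p b) i -> meets p i.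
Proof.
move=> bA [y hy Uy]; exists (phi b y) => //; apply: nicf_map_le; first exact: dA.
by lra.
Qed.

(* A covering set meeting two sibling cylinders is too long to be cheap. *)
Lemma cheap_meets_unique p b b' i : cheap p -> b \in A -> b' \in A ->
  meets (branch_step p b) i -> meets (branch_step p b') i -> b = b'.
Proof.
move=> [hp pc] bA b'A mb mb'; apply/eqP/negPn/negP => bb'.
have := cost_ge (meets_step bA mb).
rewrite leNgt => /negP; apply; apply: lt_le_trans pc _; rewrite lee_fin.
have [D0 r25 _] := hp.
case: mb mb' => y hy Uy [z hz Uz].
apply: le_trans (aU Uy Uz) => /=.
have y2 : inX y by lra.
have z2 : inX z by lra.
have /andP[hd _] := branch_map_dist hp (nicf_map_inX (dA bA) y2) (nicf_map_inX (dA b'A) z2).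
have hg := gapP bA b'A bb' hy hz.
apply: (@le_trans _ _ ((25 / 36 * gap * branch_size p) `^ s)); last first.
  apply: ge0_ler_powR; rewrite ?nnegrE ?(ltW s0)//.
    by rewrite !mulr_ge0 ?(ltW D0) ?(ltW gap0).
  apply: le_trans hd.
  by rewrite mulrAC ler_wpM2l// mulr_ge0// ltW.
rewrite powRM ?(ltW D0)//; last by rewrite mulr_ge0 ?(ltW gap0).
rewrite mulrAC ler_wpM2r ?powR_ge0// /c mulrAC ler_pdivrMr// ler_wpM2l ?powR_ge0//.
by apply: hM; lra.
Qed.

(** Each covering set is charged to at most one child. *)
Lemma cost_children p : cheap p ->
  (\sum_(b <- A) cost (branch_step p b) <= cost p)%E.
Proof.
move=> hp; rewrite -nneseries_sum//.
apply: lee_nneseries => i _; first by move=> _; apply: sume_ge0.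
rewrite sumEFin lee_fin.
have [[b bA mb]|none] := pselect (exists2 b, b \in A & meets (branch_step p b) i).
  rewrite (bigD1_seq b)//= (asboolT mb) (asboolT (meets_step bA mb)).
  rewrite big_seq_cond big1 ?addr0// => b' /andP[b'A b'b]; case: asboolP => // mb'.
  by move: b'b; rewrite (cheap_meets_unique hp bA b'A mb mb') eqxx.
rewrite big_seq big1 => [|b bA]; first by case: ifP => // _; exact: ltW.
by case: asboolP => // mb; case: none; exists b.
Qed.

(** Averaging: if no child were cheap, adding up their costs and using L h >= h would make the
    parent too expensive. *)
Lemma cheap_child p : cheap p -> exists2 b, b \in A & cheap (branch_step p b).
Proof.
move=> hp; have [//|none] := pselect (exists2 b, b \in A & cheap (branch_step p b)).
have [hv pc] := hp; have [D0 r25 _] := hv.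
have r2 : inX (branch_ratio p) by lra.
have c0 : 0 <= c by rewrite divr_ge0 ?powR_ge0// ltW.
exfalso; move: pc; apply/negP; rewrite -leNgt.
apply: le_trans (cost_children hp).
apply: (@le_trans _ _ (c * branch_size p `^ s * transfer s A h (branch_ratio p))%:E).
  by rewrite lee_fin ler_wpM2l ?hsub// mulr_ge0// powR_ge0.
rewrite /transfer mulr_sumr -sumEFin !big_seq; apply: lee_sum => b bA.
rewrite leNgt; apply/negP => hc; apply: none; exists b => //.
split; first exact: branch_valid_step (dA bA) hv.
apply: lt_le_trans hc _; rewrite lee_fin /= powRM ?sqr_ge0 ?(ltW D0)//.
by rewrite !mulrA.
Qed.

Lemma descent : cheap branch0 ->
  exists w x, [/\ forall n, w n \in A, ifs_code phi X w x & forall i, ~ U i x].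
Proof.
move=> hp0.
have /choice[g gP] : forall p, exists b,
    cheap p -> b \in A /\ cheap (branch_step p b).
  move=> p; have [hp|hp] := pselect (cheap p); last by exists 0%:Z.
  by have [b bA hb] := cheap_child hp; exists b.
pose P n := iter n (fun p => branch_step p (g p)) branch0.
pose w n := g (P n).
have PE n : P n = branch_of (mkseq w n).
  by elim: n => [//|n IH]; rewrite branch_of_mkseqS -IH.
have Pc n : cheap (P n) by elim: n => [//|n IH]; have [] := gP _ IH.
have wA n : w n \in A by have [] := gP _ (Pc n).
have wF n : nicf_alphabet (w n) by exact: dA.
have [x [xw xP]] := nicf_code_exists wF.
exists w, x; split => // i Uix.
(* If [U i] contained x, it would meet every cylinder [P n], whose costs tend to 0, contradicting
   [a i > 0]. *)
have aiD n : a i <= c * branch_size (P n) `^ s * M.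
  have [hv hc] := Pc n; have [D0 r25 _] := hv.
  have mi : meets (P n) i by have [y hy yx] := xP n; exists y => //; rewrite PE yx.
  have := le_lt_trans (cost_ge mi) hc; rewrite lte_fin => /ltW h1.
  apply: le_trans h1 _; rewrite ler_wpM2l ?hM//; last by lra.
  by rewrite mulr_ge0 ?powR_ge0// divr_ge0 ?powR_ge0// ltW.
have c0 : 0 < c by rewrite divr_gt0 ?powR_gt0// mulr_gt0.
have [|||n hn] := @small_expr ((4 / 25) `^ s) (a i / (c * M)).
- exact: powR_ge0.
- rewrite [ltRHS](_ : _ = 1 `^ s); last by rewrite powR1.
  by apply: gt0_ltr_powR; rewrite ?nnegrE//; lra.
- by rewrite divr_gt0// mulr_gt0.
have := aiD n; rewrite leNgt => /negP; apply.
rewrite mulrAC mulrC -(ltr_pdivlMr _ _ (mulr_gt0 c0 M0)).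
apply: le_lt_trans hn; rewrite -powR_mulrn ?powR_ge0// -powRrM (mulrC s) powRrM powR_mulrn//; [|lra..].
have [[D0 _ _] _] := Pc n.
apply: ge0_ler_powR; rewrite ?nnegrE ?(ltW s0) ?(ltW D0) ?exprn_ge0//.
rewrite PE; have := branch_of_size (digits_mkseq (n := n) wF).
by rewrite size_mkseq.
Qed.

End Descent.

(** By distortion L^N 1 >= 1 everywhere, so the sum h of the L^k 1 for k < N satisfies L h >= h and
    feeds the descent. *)
Lemma uncovered_code s A N x0 : 0 < s <= 1 -> digits A -> uniq A -> inX x0 ->
  9 / 4 < pressure_sum s A N x0 ->
  exists2 e : R, 0 < e & forall (a : nat -> R) (U : nat -> set R),
   (forall i, 0 < a i) -> (forall i x y, U i x -> U i y -> `|x - y| `^ s <= a i) ->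
   (\sum_(0 <= i <oo) (a i)%:E < e%:E)%E ->
  exists w x, [/\ forall n, w n \in A, ifs_code phi X w x & forall i, ~ U i x].
Proof.
move=> /andP[s0 s1] dA uA hx0 hN.
have hs : 0 <= s <= 1 by rewrite ltW.
have inX0 : inX (0 : R) by rewrite normr0 invr_ge0.
have [gap gap0 gapP] := nicf_map_separation dA.
pose h y := \sum_(k < N) pressure_sum s A k y.
have N0 : (0 < N)%N by case: (N) hN => //=; rewrite /pressure_sum/=; lra.
have h1 : 1 <= h 0.
  rewrite /h; case: (N) N0 => // K _.
  rewrite big_ord_recl (_ : pressure_sum s A ord0 0 = 1)//.
  by rewrite lerDl sumr_ge0// => k _; exact: pressure_sum_ge0.
have hM y : inX y -> h y <= 9 / 4 * h 0.
  move=> hy; rewrite /h mulr_sumr; apply: ler_sum => k _.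
  exact: pressure_sum_distortion.
have M0 : 0 < 9 / 4 * h 0 by lra.
have hsub y : inX y -> h y <= transfer s A h y.
  move=> hy; rewrite transfer_sum_pressure -/(h y).
  by have := pressure_sum_distortion N hs dA hx0 hy; lra.
(* This is the constant c of the descent for M = 9/4 * h 0; as h 0 >= 1, a cover of smaller total
   cost makes [branch0] cheap. *)
exists ((25 / 36 * gap) `^ s / (9 / 4 * h 0)).
  by rewrite divr_gt0// powR_gt0// mulr_gt0.
move=> a U a0 aU ale.
apply: (descent s0 dA uA gap0 gapP hM M0 hsub a0 aU); split; first exact: branch_valid0.
apply: le_lt_trans (_ : (\sum_(0 <= i <oo) (a i)%:E < _)%E).
  apply: lee_nneseries => i _; first by move=> _; rewrite lee_fin; case: ifP => // _; exact: ltW.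
  rewrite lee_fin.
  by case: ifP => // _; exact: ltW.
apply: lt_le_trans ale _; rewrite lee_fin /= powR1 mulr1.
by rewrite -[leLHS]mulr1 ler_wpM2l// divr_ge0 ?powR_ge0// ltW.
Qed.

Lemma dim_lt_subcritical s (G : set int) : G `<=` nicf_alphabet -> 0 < s <= 1 ->
  (hausdorff_dim (limit_set phi X G) < s%:E)%E -> subcritical s G.
Proof.
move=> GF hs /ereal_inf_lt[_ [s1 [s1ge0 hs1] <-]]; rewrite lte_fin => s1s.
move=> A uA hA N x0 hx0; rewrite leNgt; apply/negP => hN.
have dA : digits A by move=> b /hA /GF.
have s0 : 0 < s by case/andP: hs.
have [e e0 he] := uncovered_code hs dA uA hx0 hN.
have : (hausdorff_premeasure s1 1 (limit_set phi X G) < (e / 2)%:E)%E.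
  apply: (@le_lt_trans _ _ 0%E); last by rewrite lte_fin divr_gt0.
  by rewrite -hs1; apply: ereal_sup_ubound; exists 1 => //=; exact: ltr01.
move=> /ereal_inf_lt[_ [U [cov dU] <-] sumU].
(* The cover was taken at scale 1, so its diameters are at most 1 and passing from s1 to the larger
   s lowers the cost. *)
have small i : exists2 d : R, (diam_pow s (U i) = d%:E) & (d%:E <= diam_pow s1 (U i))%E
    /\ 0 <= d /\ forall x y, U i x -> U i y -> `|x - y| `^ s <= d.
  rewrite /diam_pow; case: ifPn => [/eqP->|/set0P[z Uz]].
    by exists 0 => //; split => //; split => // x y [].
  have [d dE /andP[d0 d1]] := diam_fin Uz (dU i).
  exists (d `^ s); rewrite dE !poweR_EFin//; split.
    rewrite lee_fin; have [->|dn0] := eqVneq d 0.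
      by rewrite powR0 ?powR_ge0// gt_eqF.
    by apply: ger_powR; [rewrite lt_neqAle eq_sym dn0 d0 d1|exact: ltW].
  split; first exact: powR_ge0.
  move=> x y Ux Uy; apply: ge0_ler_powR; rewrite ?nnegrE ?(ltW s0)//.
  rewrite -lee_fin -dE; apply: ereal_sup_ubound; exists x => //; by exists y.
(* The descent needs positive costs, while empty sets and singletons cost 0. The added terms sum to
   e/4, which keeps the total below e/2 + e/4. *)
pose a i : R := fine (diam_pow s (U i)) + (e / 4) / (2 ^ i.+1)%:R.
have eps0 i : 0 < (e / 4) / (2 ^ i.+1)%:R.
  by rewrite divr_gt0 ?divr_gt0// ltr0n expn_gt0.
have [|||w [x [wA xw xU]]] := he a U.
- move=> i; rewrite /a; have [d -> [_ [d0 _]]] := small i.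
  by rewrite ltr_wpDl.
- move=> i x y Ux Uy; rewrite /a; have [d -> [_ [d0 dxy]]] := small i.
  by apply: le_trans (dxy x y Ux Uy) _; rewrite lerDl ltW.
- apply: le_lt_trans (_ : (\sum_(0 <= i <oo)
    (diam_pow s1 (U i) + ((e / 4) / (2 ^ i.+1)%:R)%:E) < _)%E).
    apply: lee_nneseries => i _; first by move=> _; rewrite lee_fin /a;
      have [d -> [_ [d0 _]]] := small i; rewrite addr_ge0// ltW.
    rewrite /a EFinD leeD2r//; have [d -> [h _]] := small i; exact: h.
  apply: le_lt_trans (epsilon_trick _ _ _) _.
  - by move=> i; exact: diam_pow_ge0.
  - by rewrite divr_ge0// ltW.
  apply: lt_le_trans (_ : ((e / 2)%:E + (e / 4)%:E <= _)%E); first by rewrite lteD2rE.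
  by rewrite -EFinD lee_fin; lra.
have : limit_set phi X G x by exists w => // n; exact/hA/wA.
by move=> /cov[i _]; exact: xU.
Qed.

(** * The greedy subsystem *)

Definition digit (k : nat) : int :=
  if odd k then - (k./2 + 3)%:Z else (k./2 + 3)%:Z.

Lemma abs_digit k : `|digit k|%N = (k./2 + 3)%N.
Proof. by rewrite /digit; case: odd; lia. Qed.

Lemma digit_alphabet k : nicf_alphabet (digit k).
Proof. by rewrite /nicf_alphabet/=; have := abs_digit k; lia. Qed.

Lemma digit_surj b : nicf_alphabet b -> exists k, b = digit k.
Proof.
rewrite /nicf_alphabet/= => hb; case: (leP 0 b) => b0.
  by exists (`|b| - 3).*2; rewrite /digit odd_double doubleK; lia.
by exists (`|b| - 3).*2.+1; rewrite /digit /= odd_double /= uphalf_double; lia.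
Qed.

Fixpoint greedy t n : set int := if n is m.+1 then
    if `[< subcritical t (greedy t m `|` [set digit m]) >]
    then greedy t m `|` [set digit m] else greedy t m
  else set0.

Definition greedy_limit t := \bigcup_n greedy t n.

Lemma greedy_le t m n : (m <= n)%N -> greedy t m `<=` greedy t n.
Proof.
move=> mn; rewrite -(subnK mn); elim: (n - m)%N => [//|k IH].
by apply: (subset_trans IH); rewrite addSn /=; case: asboolP => _ b hb //; left.
Qed.

Lemma greedyP t n b : greedy t n b -> exists2 k, (k < n)%N & b = digit k.
Proof.
elim: n => [//|n IH] /=; case: asboolP => _.
  by case=> [/IH[k kn ->]|->]; [exists k => //; exact: ltnW | exists n].
by move=> /IH[k kn ->]; exists k => //; exact: ltnW.
Qed.

Lemma greedy_limit_alphabet t : greedy_limit t `<=` nicf_alphabet.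
Proof. by move=> b [n _ /greedyP[k _ ->]]; exact: digit_alphabet. Qed.

Lemma subcritical_set0 s : subcritical s set0.
Proof.
move=> [|b A] uA hA; last by have := hA b (mem_head _ _).
move=> [|n] x _; rewrite /pressure_sum /=; first by lra.
by rewrite /transfer big_nil; lra.
Qed.

Lemma subcritical_greedy t n : subcritical t (greedy t n).
Proof.
elim: n => [|n IH] /=; first exact: subcritical_set0.
by case: asboolP.
Qed.

Lemma greedy_limit_finite t (A : seq int) : (forall b, b \in A -> greedy_limit t b) ->
  exists n, forall b, b \in A -> greedy t n b.
Proof.
elim: A => [|a A IH] hA; first by exists 0%N.
have [|n hn] := IH; first by move=> b bA; apply: hA; rewrite inE bA orbT.
have [m _ hm] := hA a (mem_head _ _).
exists (maxn m n) => b; rewrite inE => /orP[/eqP->|/hn].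
  by apply: greedy_le hm; exact: leq_maxl.
by apply: greedy_le; exact: leq_maxr.
Qed.

(** Subcriticality tests only finite subsets, and each of them lies in one stage. *)
Lemma subcritical_greedy_limit t : subcritical t (greedy_limit t).
Proof.
by move=> A uA /greedy_limit_finite[n hA]; exact: (@subcritical_greedy t n).
Qed.

Lemma greedy_limit_digit t n : subcritical t (greedy t n `|` [set digit n]) ->
  greedy_limit t (digit n).
Proof. by move=> h; exists n.+1 => //=; rewrite asboolT//; right. Qed.

(* Replacing the last rejected digit by the tail that follows it does not
   decrease pressure sums, so that digit would have been accepted. *)
Lemma greedy_tail_accept t k : 0 <= t <= 1 ->
  (forall m, (k < m)%N -> greedy_limit t (digit m)) ->
  subcritical t (greedy t k `|` [set digit k]).
Proof.
move=> ht hk A uA hA n x hx.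
pose A' := [seq a <- A | a != digit k].
have hA' b : b \in A' -> greedy t k b.
  by rewrite mem_filter => /andP[/eqP bk /hA[//|/bk]].
have dA' : digits A'.
  by move=> b /hA' h; apply: (@greedy_limit_alphabet t); exists k.
have dkA' : digits (digit k :: A').
  by move=> c; rewrite inE => /orP[/eqP->|/dA'//]; exact: digit_alphabet.
have AA' : {subset A <= digit k :: A'}.
  by move=> c cA; rewrite inE mem_filter cA andbT orbN.
pose m := `|digit k|%N; pose T := tail_digits m (9 * m.+1).
have mE : m = (k./2 + 3)%N by exact: abs_digit.
have dT : digits T by apply: digits_tail; lia.
apply: le_trans (pressure_sum_sub t n uA AA' dkA' hx) _.
apply: le_trans (pressure_sum_replace ht (digit_alphabet k) dA' dT _ n hx) _ => //.
apply: (@subcritical_greedy_limit t) => //.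
  (* Digits scanned before [digit k] are no larger in absolute value, so they miss the tail. *)
  rewrite cat_uniq filter_uniq// uniq_tail_digits andbT; apply/hasPn => b.
  rewrite mem_tail_digits => /andP[mb _]; apply/negP => /hA'/greedyP[j jk bj].
  move: mb; rewrite bj abs_digit mE ltn_add2r ltnNge => /negP; apply.
  by apply: half_leq; exact: ltnW.
move=> b; rewrite mem_cat => /orP[/hA' h|bT]; first by exists k.
have [j bj] := digit_surj (dT b bT).
move: bT; rewrite bj mem_tail_digits abs_digit mE => /andP[kj _].
apply: hk; rewrite ltnNge; apply/negP => jk.
by have := half_leq jk; lia.
Qed.

Lemma greedy_limit_dim t : 0 < t <= 1 ->
  (t%:E <= hausdorff_dim (limit_set phi X nicf_alphabet))%E ->
  hausdorff_dim (limit_set phi X (greedy_limit t)) = t%:E.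
Proof.
move=> /andP[t0 t1] htF; apply/eqP; rewrite eq_le.
rewrite (subcritical_hausdorff_dim (@greedy_limit_alphabet t) (ltW t0)
  (@subcritical_greedy_limit t)) /=.
rewrite leNgt; apply/negP => dimlt.
have [s [s0 st dims]] : exists s, [/\ 0 < s, s < t &
    (hausdorff_dim (limit_set phi X (greedy_limit t)) < s%:E)%E].
  have /ereal_inf_lt[_ [s1 hs1 <-]] := dimlt; rewrite lte_fin => s1t.
  have s10 : 0 <= s1 by case: hs1.
  (* The midpoint is positive even if s1 = 0, as [dim_lt_subcritical] requires. *)
  exists ((s1 + t) / 2); split; [lra|lra|].
  apply: (@le_lt_trans _ _ s1%:E); last by rewrite lte_fin; lra.
  by apply: ereal_inf_lbound; exists s1.
have hsG : subcritical s (greedy_limit t).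
  by apply: (dim_lt_subcritical (@greedy_limit_alphabet t) _ dims); lra.
have [E hE] := subcritical_add_digit (@greedy_limit_alphabet t) (ltW s0) st t1 hsG.
have acc k : E <= `|(digit k)%:~R| -> subcritical t (greedy t k `|` [set digit k]).
  move=> /(hE _ (digit_alphabet k)); apply: subcritical_le.
  by move=> b [hb|hb]; [left; exists k | right].
pose rejected k := ~~ `[< subcritical t (greedy t k `|` [set digit k]) >].
have [[k0 hk0]|none] := pselect (exists k, rejected k); last first.
  (* Without rejection the outcome is the full alphabet, of dimension at least t by [htF]. *)
  move: dimlt; apply/negP; rewrite -leNgt.
  suff -> : greedy_limit t = nicf_alphabet by [].
  apply/seteqP; split => [|b /digit_surj[k ->]]; first exact: greedy_limit_alphabet.
  by apply: greedy_limit_digit; apply: contrapT => hk; apply: none; exists k; apply/asboolPn.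
have bounded k : rejected k -> (k <= (Num.bound `|E|).*2)%N.
  rewrite leqNgt => /asboolPn hk; apply/negP => kb; apply/hk/acc.
  apply: (le_trans (ler_norm E)); apply: ltW; apply: lt_le_trans (archi_boundP (normr_ge0 E)) _.
  rewrite -intr_norm pmulrn ler_int -abszE lez_nat abs_digit.
  by have := half_leq (ltnW kb); rewrite doubleK => h; exact: leq_trans h (leq_addr _ _).
case: (ex_maxnP (ex_intro _ k0 hk0) bounded) => k /asboolPn hk kmax.
apply/hk/greedy_tail_accept => [|m km]; first by lra.
apply: greedy_limit_digit; apply: contrapT => /asboolPn hm.
by have := kmax m hm; rewrite leqNgt km.
Qed.

End NearestIntegerSpectrum.

Theorem theorem1 (R : realType) :
  full_hausdorff_dim_spectrum (@nicf_map R) `[- 2^-1, 2^-1] nicf_alphabet.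
Proof.
move=> t t0 ht; have [->|tn0] := eqVneq t 0.
  (* The greedy argument needs t > 0; for t = 0 the empty alphabet serves. *)
  exists set0; first exact: sub0set.
  apply/eqP; rewrite eq_le; apply/andP; split.
    apply: subcritical_hausdorff_dim => //; exact: subcritical_set0.
  by apply: le_ereal_inf_tmp => _ [s [s0 _] <-]; rewrite lee_fin.
exists (greedy_limit t); first exact: greedy_limit_alphabet.
apply: greedy_limit_dim => //; apply/andP; split; first by rewrite lt_def tn0.
rewrite -lee_fin; apply: (le_trans ht).
apply: subcritical_hausdorff_dim => //; exact: subcritical1.
Qed.
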